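(* Let $\mathcal{H}$ be a reproducing kernel Hilbert space on a set $X$ and let $g \in \operatorname{Mult}(\mathcal{H})$. Then the Berezin range $B(M_g)$ of the multiplication operator $M_g$ is convex if and only if $g(X) = \{g(x) : x \in X\} \subseteq \mathbb{C}$ is convex.
   Context: A reproducing kernel Hilbert space (RKHS) on a set $X$ is a Hilbert space $\mathcal{H}$ of functions $X \to \mathbb{C}$ for which every point evaluation $f \mapsto f(x)$, $x \in X$, is a bounded linear functional. The reproducing kernel at $x$ is the unique $k_x \in \mathcal{H}$ with $\langle f, k_x\rangle_{\mathcal{H}} = f(x)$ for all $f \in \mathcal{H}$. It is assumed that $k_x \neq 0$ for every $x \in X$, so that the normalized reproducing kernel $\hat{k}_x = k_x/\|k_x\|_{\mathcal{H}}$ is defined. For a bounded linear operator $T$ on $\mathcal{H}$, the Berezin range of $T$ is $B(T) = \{\langle T\hat{k}_x, \hat{k}_x\rangle_{\mathcal{H}} : x \in X\} \subseteq \mathbb{C}$. $\operatorname{Mult}(\mathcal{H}) = \{ g \in \mathcal{H} : gf \in \mathcal{H} \text{ for all } f \in \mathcal{H}\}$, and for $g \in \operatorname{Mult}(\mathcal{H})$ the multiplication operator $M_g$ on $\mathcal{H}$ is $M_g f = gf$. *)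

(* Defs.v *)
From HB Require Import structures.
From mathcomp Require Import all_boot all_order all_algebra sesquilinear complex.
From mathcomp Require Import all_classical all_reals all_analysis.

Set Implicit Arguments.
Unset Strict Implicit.
Unset Printing Implicit Defensive.

Import Order.TTheory GRing.Theory Num.Theory.
Import numFieldNormedType.Exports.

Local Open Scope classical_set_scope.
Local Open Scope ring_scope.
Local Open Scope complex_scope.

HB.mixin Record isHilbert (R : realType) H of CompleteNormedModule R[i] H := {
  inner : {dot H for Num.conj};
  sqr_norm_inner : forall f : H, `|f| ^+ 2 = inner f f
}.

#[short(type="hilbertType")]
HB.structure Definition Hilbert (R : realType) :=
  {H of isHilbert R H & CompleteNormedModule R[i] H}.

(* The elements of [H] are the functions satisfying [P], and [\val f] is the
   element [f] seen as a function; [SubLmodule] says that the linear structure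
   of [H] is the pointwise one. *)
HB.mixin Record hasBoundedEval (R : realType) (X : Type) (P : pred (X -> R[i]))
    H of Hilbert R H & @GRing.SubLmodule R[i] (X -> R[i])%type P H := {
  eval_bounded : forall x : X, exists M : R,
    forall f : H, `|(\val f : X -> R[i]) x| <= M%:C * `|f|
}.

#[short(type="rkhsType")]
HB.structure Definition RKHS (R : realType) (X : Type) (P : pred (X -> R[i])) :=
  {H of Hilbert R H & @GRing.SubLmodule R[i] (X -> R[i])%type P H
      & hasBoundedEval R X P H}.

Section BerezinRange.
Context (R : realType) (X : Type) (P : pred (X -> R[i])) (H : rkhsType P).
Implicit Types (x : X) (f g : H).

(* By Riesz's theorem such a vector exists, so the default value [0] is never
   used; it is unique since [inner] is positive definite. *)
Definition reproducing_kernel x : H :=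
  xget 0 [set k : H | forall f, inner f k = (\val f : X -> R[i]) x].

Definition normalized_kernel x : H :=
  `|reproducing_kernel x|^-1 *: reproducing_kernel x.

(* Boundedness of [T] is not required: only its values enter the definition.
   Multiplication operators are bounded by the closed graph theorem. *)
Definition berezin_range (T : {linear H -> H}) : set R[i] :=
  [set inner (T (normalized_kernel x)) (normalized_kernel x) | x in [set: X]].

Definition Mult : set H :=
  [set g | forall f, P ((\val g : X -> R[i]) \* (\val f : X -> R[i]))].

Definition mulop g (gM : Mult g) (f : H) : H := Sub _ (gM f).

Fact mulop_linear g (gM : Mult g) : linear (mulop gM).
Proof.
move=> a f h; apply: val_inj; rewrite linearP /= !SubK linearP.
by apply/funext => x /=; rewrite mulrDr mulrCA.
Qed.

HB.instance Definition _ g (gM : Mult g) :=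
  GRing.isLinear.Build R[i] H H *:%R (mulop gM) (mulop_linear gM).

End BerezinRange.

(* Main.v *)
Require Import Defs.
From mathcomp Require Import all_boot all_order all_algebra complex sesquilinear ring.
From mathcomp Require Import all_classical all_reals all_analysis.

(** The two sets are equal, so convexity of one is convexity of the other.
    Evaluation at [x] is the inner product against [k_x], hence
    [<g k_x, k_x> = g x * k_x x = g x * <k_x, k_x> = g x * `|k_x| ^+ 2], and
    normalizing [k_x] divides this by [`|k_x| ^+ 2]: the Berezin range of
    [M_g] has the value [g x] at [x]. *)

Import GRing.Theory Num.Theory.
Local Open Scope classical_set_scope.
Local Open Scope ring_scope.

(** A nonzero [reproducing_kernel H x] is not the default value [0] of the
    choice that defines it, so it satisfies the property it was chosen for. *)
Lemma inner_reproducing_kernel (R : realType) (X : Type)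
    (P : pred (X -> R[i])) (H : rkhsType P) (x : X) (f : H) :
  reproducing_kernel H x != 0 ->
  inner f (reproducing_kernel H x) = (\val f : X -> R[i]) x.
Proof.
rewrite /reproducing_kernel; case: xgetP => [k _ kE _|_]; first exact: kE.
by rewrite eqxx.
Qed.

Lemma inner_mulop_normalized_kernel (R : realType) (X : Type)
    (P : pred (X -> R[i])) (H : rkhsType P) (g : H) (gM : Mult g) (x : X) :
  reproducing_kernel H x != 0 ->
  inner (mulop gM (normalized_kernel H x)) (normalized_kernel H x) =
  (\val g : X -> R[i]) x.
Proof.
move=> k0; have kE f := @inner_reproducing_kernel R X P H x f k0.
rewrite /normalized_kernel; set k := reproducing_kernel H x in k0 kE *.
have nk0 : `|k| != 0 by rewrite normr_eq0.
rewrite [mulop gM _]linearZ linearZl_LR linearZr_LR /= kE SubK /= -(kE k) -sqr_norm_inner.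
(* The second slot is conjugate-linear, and the scalar there is real. *)
rewrite (CrealP (ger0_real _)) ?invr_ge0 //.
by field.
Qed.

Lemma berezin_range_mulop (R : realType) (X : Type) (P : pred (X -> R[i]))
    (H : rkhsType P) (kernel_neq0 : forall x : X, reproducing_kernel H x != 0)
    (g : H) (gM : Mult g) :
  berezin_range (mulop gM) = range (\val g : X -> R[i]).
Proof.
by apply: eq_imagel => x _; apply: inner_mulop_normalized_kernel.
Qed.

Theorem proposition3p2 (R : realType) (X : Type) (P : pred (X -> R[i]))
    (H : rkhsType P) (kernel_neq0 : forall x : X, reproducing_kernel H x != 0)
    (g : H) (gM : Mult g) :
  @convex_set R (Rcomplex R) (berezin_range (mulop gM)) <->
  @convex_set R (Rcomplex R) (range (\val g : X -> R[i])).
Proof. by rewrite berezin_range_mulop. Qed.
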